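(* Let $G$ be a finite simple graph with vertices totally ordered as $v_1<v_2<\cdots<v_n$, and let $P(G,t)$ be its chromatic polynomial. Then $P(G,t)=IF(G,t)$ if and only if $v_1<v_2<\cdots<v_n$ is a perfect elimination ordering, i.e., for each $i$ the neighbors of $v_i$ that come before $v_i$ in the ordering form a clique of $G$.
   Context: A subtree of $G$ is increasing if the vertices along any path starting at its minimum vertex increase in the ordering. Let $f_k$ be the number of spanning forests of $G$ with $k$ edges all of whose components are increasing trees. The increasing spanning forest generating function is $IF(G,t)=\sum_{k=0}^{n-1}(-1)^k f_k t^{n-k}$. *)

(* Defs.v *)
From HB Require Import structures.
From mathcomp Require Import all_boot all_order all_algebra.
Set Implicit Arguments.
Unset Strict Implicit.
Unset Printing Implicit Defensive.
Import Order.TTheory GRing.Theory Num.Theory.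
Local Open Scope ring_scope.

(* A simple graph on T is a symmetric irreflexive relation e : rel T. *)

Definition proper_coloring (T : finType) (e : rel T) (q : nat)
    (f : {ffun T -> 'I_q}) : bool :=
  [forall x, forall y, e x y ==> (f x != f y)].

Definition num_colorings (T : finType) (e : rel T) (q : nat) : nat :=
  #|[set f : {ffun T -> 'I_q} | proper_coloring e f]|.

Definition is_chromatic_poly (T : finType) (e : rel T) (p : {poly int}) :=
  forall q : nat, p.[q%:R] = (num_colorings e q)%:R.

(* Deletion-contraction, for an edge list that may contain loops. *)
Lemma separating_poly (T : finType) (L : seq (T * T)) :
  {p : {poly int} | forall q : nat,
    p.[q%:R] = #|[set f : {ffun T -> 'I_q} | all (fun u => f u.1 != f u.2) L]|%:R}.
Proof.
move En: (size L) => n; elim: n T L En => [|n IHn] T L.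
  move/eqP/nilP => ->; exists ('X^#|T|) => q.
  rewrite hornerXn -natrX; congr _%:R.
  rewrite -[in LHS](card_ord q) -card_ffun -cardsT.
  by apply: eq_card => f; rewrite !inE.
case: L => [//|[x y] L] /= [sL].
have [p1 hp1] := IHn T L sL.
have [<-|nxy] := eqVneq x y.
  exists 0 => q; rewrite horner0; set A := [set _ | _].
  suff -> : A = set0 by rewrite cards0.
  by apply/setP => f; rewrite !inE eqxx.
pose T' : finType := {z | z != y}.
pose x' : T' := Sub x nxy.
pose c (z : T) : T' := insubd x' z.
have cK (z : T') : c (val z) = z by rewrite /c valKd.
have [p2 hp2] := IHn T' [seq (c u.1, c u.2) | u <- L] (etrans (size_map _ _) sL).
exists (p1 - p2) => q; rewrite hornerD hornerN hp1 hp2.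
set A := [set f | _]; set B := [set f | _]; set C := [set f | _].
apply/eqP; rewrite subr_eq -natrD; apply/eqP; congr _%:R.
rewrite -(cardsID [set f : {ffun T -> 'I_q} | f x == f y] A) addnC; congr addn.
  by apply: eq_card => f; rewrite !inE.
pose h (g : {ffun T' -> 'I_q}) := [ffun z => g (c z)].
have hinj : injective h.
  move=> g1 g2 /ffunP E; apply/ffunP => z.
  by have := E (val z); rewrite !ffunE cK.
rewrite -(card_imset _ hinj); apply: eq_card => f.
have cx : c x = x' by rewrite /c (_ : x = val x') // valKd.
have cy : c y = x' by rewrite /c /insubd insubF // eqxx.
apply/idP/imsetP => [|[g gB ->]].
  rewrite !inE => /andP[fL /eqP fxy].
  have fc z : f (val (c z)) = f z.
    have [->|nzy] := eqVneq z y; first by rewrite cy.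
    by rewrite /c insubdK.
  exists [ffun z => f (val z)].
    rewrite inE all_map; apply/allP => u uL /=.
    by rewrite !ffunE !fc (allP fL).
  by apply/ffunP => z; rewrite !ffunE fc.
move: gB; rewrite !inE all_map !ffunE cx cy eqxx andbT => /allP gL.
by apply/allP => u /gL /=; rewrite !ffunE.
Qed.

Lemma chromatic_poly_exists (T : finType) (e : rel T) :
  {p : {poly int} | is_chromatic_poly e p}.
Proof.
have [p hp] := separating_poly [seq u <- enum {: T * T} | e u.1 u.2].
exists p => q; rewrite hp; congr _%:R; apply: eq_card => f; rewrite !inE.
apply/allP/'forall_forallP => [fL x y|fe [x y]].
  by apply/implyP => exy; apply: (fL (x, y)); rewrite mem_filter mem_enum exy.
by rewrite mem_filter => /andP[/= exy _]; apply: (implyP (fe x y)).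
Qed.

Definition chromatic_poly (T : finType) (e : rel T) : {poly int} :=
  sval (chromatic_poly_exists e).

Lemma chromatic_polyP (T : finType) (e : rel T) :
  is_chromatic_poly e (chromatic_poly e).
Proof. exact: svalP. Qed.

Lemma chromatic_poly_unique (T : finType) (e : rel T) (p : {poly int}) :
  is_chromatic_poly e p -> p = chromatic_poly e.
Proof.
move=> hp; apply/eqP; rewrite -subr_eq0; apply/negPn/negP => nz.
set d := p - _ in nz.
pose rs : seq int := [seq k%:R | k <- iota 0 (size d)].
suff /(max_poly_roots nz) : all (root d) rs.
  rewrite size_map size_iota ltnn => /(_ _)/negP; apply=> //.
  by rewrite map_inj_uniq ?iota_uniq // => i j /eqP; rewrite eqr_nat => /eqP.
apply/allP => _ /mapP[k _ ->]; rewrite rootE /d hornerD hornerN.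
by rewrite hp chromatic_polyP subrr.
Qed.

Definition edges (T : finType) (e : rel T) : {set {set T}} :=
  [set [set u.1; u.2] | u : T * T & e u.1 u.2].

(* The spanning subgraph of G with edge set F; F contains no singletons when
   F \subset edges e and e is irreflexive. *)
Definition subgraph (T : finType) (F : {set {set T}}) : rel T :=
  [rel x y | [set x; y] \in F].

(* [:: x; y] with r x y is a [cycle] traversing one edge back and forth, so a
   graph cycle has size at least 3.  Bounding the size by #|T| loses nothing on
   duplicate-free sequences; see acyclicP. *)
Definition acyclic (T : finType) (r : rel T) : bool :=
  [forall k : 'I_#|T|.+1, forall c : k.-tuple T,
    (cycle r c && uniq c) ==> (k < 3)%N].

Lemma acyclicP (T : finType) (r : rel T) :
  reflect (forall c : seq T, cycle r c -> uniq c -> (size c < 3)%N)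
          (acyclic r).
Proof.
apply: (iffP 'forall_forallP) => [H c cc uc|H k c].
  have sc : (size c < #|T|.+1)%N by rewrite ltnS -(card_uniqP uc) max_card.
  by have /implyP := H (Ordinal sc) (in_tuple c); rewrite cc uc; apply.
by apply/implyP => /andP[cc uc]; rewrite -[X in (X < _)%N](size_tuple c) H.
Qed.

Definition spanning_forest (T : finType) (e : rel T) (F : {set {set T}}) :=
  (F \subset edges e) && acyclic (subgraph F).

Definition component_min (d : Order.disp_t) (T : finOrderType d) (r : rel T)
    (x : T) : bool :=
  [forall y, connect r x y ==> (x <= y)%O].

Definition increasing_from (d : Order.disp_t) (T : finOrderType d) (r : rel T)
    (x : T) : bool :=
  [forall k : 'I_#|T|, forall p : k.-tuple T,
    (path r x p && uniq (x :: p)) ==> path <%O x p].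

Lemma increasing_fromP (d : Order.disp_t) (T : finOrderType d) (r : rel T)
    (x : T) :
  reflect (forall p : seq T, path r x p -> uniq (x :: p) -> path <%O x p)
          (increasing_from r x).
Proof.
apply: (iffP 'forall_forallP) => [H p pp up|H k p].
  have sp : (size p < #|T|)%N.
    by have := max_card (mem (x :: p)); rewrite (card_uniqP up).
  by have /implyP := H (Ordinal sp) (in_tuple p); rewrite pp up; apply.
by apply/implyP => /andP[pp up]; apply: H.
Qed.

(* The components of F correspond to their minimum vertices x, and the paths of
   such a component starting at x are the duplicate-free F-paths from x. *)
Definition increasing_spanning_forest (d : Order.disp_t) (T : finOrderType d)
    (e : rel T) (F : {set {set T}}) : bool :=
  spanning_forest e F &&
  [forall x, component_min (subgraph F) x ==> increasing_from (subgraph F) x].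

Definition num_isf (d : Order.disp_t) (T : finOrderType d) (e : rel T)
    (k : nat) : nat :=
  #|[set F : {set {set T}} | increasing_spanning_forest e F & #|F| == k]|.

Definition isf_poly (d : Order.disp_t) (T : finOrderType d) (e : rel T) :
    {poly int} :=
  \sum_(k < #|T|) ((-1) ^+ k * (num_isf e k)%:R) *: 'X^(#|T| - k).

Definition clique (T : finType) (e : rel T) (A : {set T}) : Prop :=
  {in A &, forall x y, x != y -> e x y}.

Definition perfect_elimination (d : Order.disp_t) (T : finOrderType d)
    (e : rel T) : Prop :=
  forall v : T, clique e [set x | e v x & (x < v)%O].

(* Main.v *)
Require Import Defs.
From HB Require Import structures.
From mathcomp Require Import all_boot all_order all_algebra.

Set Implicit Arguments.
Unset Strict Implicit.
Unset Printing Implicit Defensive.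
Import Order.TTheory GRing.Theory Num.Theory.

(** Writing [d_v] for the number of neighbours of [v] below [v], both
    polynomials are compared with [\prod_v ('X - d_v)].  A set of edges is an
    increasing forest iff it joins every vertex to at most one smaller vertex;
    these parents can be chosen independently, so [isf_poly e] is the product.
    On the other side, color the vertices in increasing order: the number of
    choices at [v] is [q] minus the number of colors on its lower neighbours,
    hence at least [q - d_v], with equality iff these neighbours have distinct
    colors.  This is forced if they form a clique.  If two of them are not
    adjacent and [q >= #|T|], some coloring of the smaller vertices identifies
    their colors, so that there are strictly more than [\prod_v (q - d_v)]
    proper colorings. *)

Section PartialColorings.
Variables (T : finType) (e : rel T) (q : nat).
Implicit Types (S : {set T}) (g : {ffun T -> option 'I_q}).

Definition partial_colorings S : {set {ffun T -> option 'I_q}} :=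
  [set g : {ffun T -> option 'I_q} | [forall x, (g x != None) == (x \in S)]
     & [forall x in S, forall y in S, e x y ==> (g x != g y)]].

Definition nbrs_in S (v : T) : {set T} := [set x in S | e v x].

Definition recolor g (v : T) (o : option 'I_q) : {ffun T -> option 'I_q} :=
  [ffun x => if x == v then o else g x].

Lemma partial_coloringsP S g :
  reflect ((forall x, (g x != None) = (x \in S)) /\
           {in S &, forall x y, e x y -> g x != g y})
          (g \in partial_colorings S).
Proof.
rewrite inE; apply: (iffP andP) => -[gS gE]; split.
- by move=> x; move/forallP/(_ x)/eqP: gS.
- move=> x y xS yS; apply/implyP.
  by move/forall_inP/(_ x xS)/forall_inP: gE; apply.
- by apply/forallP => x; rewrite gS.
- apply/forall_inP => x xS; apply/forall_inP => y yS; apply/implyP.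
  exact: gE.
Qed.

Lemma card_partial_colorings0 : #|partial_colorings set0| = 1%N.
Proof.
rewrite (_ : partial_colorings set0 = [set [ffun=> None]]) ?cards1 //.
apply/setP => g; rewrite in_set1; apply/partial_coloringsP/eqP => [[gS _]|->].
  by apply/ffunP => x; rewrite ffunE; apply/eqP/negPn; rewrite gS inE.
by split=> x; rewrite ?ffunE !inE.
Qed.

Lemma card_partial_coloringsT : #|partial_colorings setT| = num_colorings e q.
Proof.
pose total (f : {ffun T -> 'I_q}) := [ffun x => Some (f x)].
have total_inj : injective total.
  move=> f1 f2 /ffunP f12; apply/ffunP => x.
  by have := f12 x; rewrite !ffunE => -[].
rewrite /num_colorings -(card_imset _ total_inj); apply: eq_card => g.
apply/partial_coloringsP/imsetP => [[gS gE]|[f]]; last first.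
  rewrite inE => /'forall_forallP fE ->; split=> [x|x y _ _ exy].
    by rewrite ffunE inE.
  by rewrite !ffunE; apply: (implyP (fE x y) exy).
have /fin_all_exists[f gf] x : exists c, g x = Some c.
  by have := gS x; rewrite inE; case: (g x) => [c|//] _; exists c.
exists (finfun f); last by apply/ffunP => x; rewrite !ffunE.
rewrite inE; apply/'forall_forallP => x y; apply/implyP => exy.
by have := gE x y (in_setT _) (in_setT _) exy; rewrite !ffunE !gf.
Qed.

Lemma partial_coloring_clique_inj S (A : {set T}) g :
  g \in partial_colorings S -> A \subset S -> clique e A ->
  {in A &, injective g}.
Proof.
move=> /partial_coloringsP[_ gE] /subsetP AS A_clique x y xA yA /eqP.
apply: contraTeq => neq_xy.
by apply: gE; rewrite ?AS //; apply: A_clique.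
Qed.

Lemma nonadjacent_same_color S a b :
  symmetric e -> irreflexive e -> (#|T| <= q)%N ->
  a \in S -> b \in S -> ~~ e a b ->
  exists2 g, g \in partial_colorings S & g a = g b.
Proof.
move=> e_sym e_irr Tq aS bS nadj_ab.
pose merge x := if x == b then a else x.
pose color x := widen_ord Tq (enum_rank (merge x)).
exists [ffun x => if x \in S then Some (color x) else None]; last first.
  by rewrite !ffunE aS bS /color /merge eqxx if_same.
apply/partial_coloringsP; split=> [x|x y xS yS exy]; rewrite !ffunE.
  by case: (x \in S).
rewrite xS yS; apply: contraTneq exy => -[/val_inj/enum_rank_inj].
rewrite /merge.
case: (eqVneq x b) => [->|_]; case: (eqVneq y b) => [->|_].
- by rewrite e_irr.
- by move=> <-; rewrite e_sym.
- by move=> ->.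
- by move=> ->; rewrite e_irr.
Qed.

Section Extension.
Variables (S : {set T}) (v : T).
Hypotheses (e_sym : symmetric e) (e_irr : irreflexive e) (vS : v \notin S).

Lemma partial_colorings_uncolor g :
  g \in partial_colorings (v |: S) -> recolor g v None \in partial_colorings S.
Proof.
have neq_v := memPn vS; move=> /partial_coloringsP[gvS gE].
apply/partial_coloringsP; split=> [x|x y xS yS exy].
  rewrite ffunE; case: (eqVneq x v) => [->|xv]; first by rewrite (negPf vS).
  by rewrite gvS in_setU1 (negPf xv).
rewrite !ffunE (negPf (neq_v x xS)) (negPf (neq_v y yS)).
by apply: gE; rewrite // in_setU1 ?xS ?yS orbT.
Qed.

Lemma mem_partial_colorings_recolor g o : g \in partial_colorings S ->
  (recolor g v o \in partial_colorings (v |: S))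
    = (o \notin None |: g @: nbrs_in S v).
Proof.
have neq_v := memPn vS; move=> /partial_coloringsP[gS gE].
rewrite in_setU1 negb_or.
apply/partial_coloringsP/andP => [[gvS gvE]|[oN oI]].
  split; first by have := gvS v; rewrite ffunE eqxx setU11.
  apply/imsetP => -[x]; rewrite inE => /andP[xS evx] ox.
  have := gvE v x (setU11 _ _) (setU1r _ xS) evx.
  by rewrite !ffunE eqxx (negPf (neq_v x xS)) ox eqxx.
have avoid x : x \in S -> e v x -> o != g x.
  move=> xS evx; apply: contraNneq oI => ->.
  by apply: imset_f; rewrite inE xS.
split=> [x|x y]; rewrite ?in_setU1 !ffunE.
  by case: (eqVneq x v) => [_|_] //=; rewrite oN.
case: (eqVneq x v) => [->|_]; case: (eqVneq y v) => [->|_] //=.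
- by rewrite e_irr.
- by move=> _; apply: avoid.
- by move=> xS _; rewrite e_sym eq_sym; apply: avoid.
- exact: gE.
Qed.

Lemma card_partial_coloring_extensions g : g \in partial_colorings S ->
  (#|[set f in partial_colorings (v |: S) | recolor f v None == g]|
    + #|g @: nbrs_in S v|)%N = q.
Proof.
move=> gS; have [gdom _] := partial_coloringsP _ _ gS.
have recolor_inj : injective (recolor g v).
  by move=> o1 o2 /ffunP/(_ v); rewrite !ffunE eqxx.
have -> : [set f in partial_colorings (v |: S) | recolor f v None == g]
    = recolor g v @: ~: (None |: g @: nbrs_in S v).
  apply/setP => f; rewrite inE; apply/andP/imsetP => [[fvS /eqP fg]|[o]].
    have fE : f = recolor g v (f v).
      by apply/ffunP => x; rewrite -fg !ffunE; case: (eqVneq x v) => [->|].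
    by exists (f v); rewrite // in_setC -mem_partial_colorings_recolor // -fE.
  rewrite in_setC -mem_partial_colorings_recolor // => fvS ->; split=> //.
  apply/eqP/ffunP => x; rewrite !ffunE; case: (eqVneq x v) => // ->.
  by apply/esym/eqP/negPn; rewrite gdom.
have noneN : None \notin g @: nbrs_in S v.
  by apply/imsetP => -[x]; rewrite inE -gdom => /andP[+ _] gx; rewrite -gx.
have cardN : #|None |: g @: nbrs_in S v| = #|g @: nbrs_in S v|.+1.
  by rewrite cardsU1 noneN.
apply: succn_inj; rewrite (card_imset _ recolor_inj) -addnS -cardN addnC.
by rewrite cardsC card_option card_ord.
Qed.

Lemma card_partial_coloringsU1 :
  (#|partial_colorings (v |: S)|
    + \sum_(g in partial_colorings S) #|g @: nbrs_in S v|)%N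
  = (#|partial_colorings S| * q)%N.
Proof.
rewrite -sum_nat_const -[in LHS]sum1_card.
rewrite (partition_big (fun f => recolor f v None) (mem (partial_colorings S)));
  last exact: partial_colorings_uncolor.
rewrite -big_split; apply: eq_bigr => g gS /=.
by rewrite sum1dep_card card_partial_coloring_extensions.
Qed.

Local Open Scope ring_scope.

Lemma card_partial_coloringsU1_leif :
  (q%:R - #|nbrs_in S v|%:R) * #|partial_colorings S|%:R
    <= #|partial_colorings (v |: S)|%:R
    ?= iff [forall g in partial_colorings S,
              #|g @: nbrs_in S v| == #|nbrs_in S v|] :> int.
Proof.
rewrite mulrBl leifBLR -!natrM -natrD leif_nat_r.
rewrite ![(_ * #|partial_colorings S|)%N]mulnC -card_partial_coloringsU1.
rewrite -sum_nat_const /leqif leq_add2l eqn_add2l.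
apply: leqif_sum => g _; split=> //; exact: leq_imset_card.
Qed.

End Extension.
End PartialColorings.

Section LowerNeighbours.
Variables (d : Order.disp_t) (T : finOrderType d).

Definition below (v : T) : {set T} := [set x | (x < v)%O].

Definition lower_nbrs (e : rel T) (v : T) : {set T} :=
  [set x | e v x & (x < v)%O].

Definition initial_segment (S : {set T}) : Prop :=
  forall x y, y \in S -> (x < y)%O -> x \in S.

Lemma initial_segmentT : initial_segment setT.
Proof. by move=> x y; rewrite !inE. Qed.

Lemma notin_below (v : T) : v \notin below v.
Proof. by rewrite inE ltxx. Qed.

Lemma nbrs_in_below (e : rel T) (v : T) :
  nbrs_in e (below v) v = lower_nbrs e v.
Proof. by apply/setP => x; rewrite !inE andbC. Qed.

Lemma lower_nbrs_below (e : rel T) (v : T) : lower_nbrs e v \subset below v.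
Proof. by apply/subsetP => x; rewrite !inE => /andP[]. Qed.

Lemma card_lower_nbrs_lt (e : rel T) (v : T) : (#|lower_nbrs e v| < #|T|)%N.
Proof.
rewrite -cardsT; apply: proper_card; apply/properP.
by split=> //; exists v; rewrite // inE ltxx andbF.
Qed.

Lemma initial_segment_ind (P : {set T} -> Prop) :
  P set0 -> (forall v, P (below v) -> P (v |: below v)) ->
  forall S, initial_segment S -> P S.
Proof.
move=> P0 PU S; have [n] := ubnP #|S|; elim: n S => // n IHn S Sn Sdown.
have [->//|[x0 x0S]] := set_0Vmem S.
have [v vS vmax] := Order.TotalTheory.arg_maxP id x0S.
have SE : S = v |: below v.
  apply/setP => x; rewrite !inE -le_eqVlt.
  apply/idP/idP => [/vmax//|]; rewrite le_eqVlt => /predU1P[->//|].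
  exact: Sdown.
rewrite SE; apply: PU; apply: IHn => [|x y]; last first.
  by rewrite !inE => yv xy; apply: lt_trans yv.
by move: Sn; rewrite SE cardsU1 notin_below.
Qed.

Local Open Scope ring_scope.

Definition lower_degree_poly (e : rel T) : {poly int} :=
  \prod_v ('X - #|lower_nbrs e v|%:R%:P).

Lemma horner_lower_degree_poly (e : rel T) (t : int) :
  (lower_degree_poly e).[t] = \prod_v (t - #|lower_nbrs e v|%:R).
Proof. by rewrite horner_prod; apply: eq_bigr => v _; rewrite !hornerE. Qed.

End LowerNeighbours.

Section ChromaticPolynomial.
Variables (d : Order.disp_t) (T : finOrderType d) (e : rel T).
Hypotheses (e_sym : symmetric e) (e_irr : irreflexive e).
Local Open Scope ring_scope.

Lemma card_partial_colorings_below_leif (q : nat) (v : T) :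
  (q%:R - #|lower_nbrs e v|%:R) * #|partial_colorings e q (below v)|%:R
    <= #|partial_colorings e q (v |: below v)|%:R
    ?= iff [forall g in partial_colorings e q (below v),
              #|g @: lower_nbrs e v| == #|lower_nbrs e v|] :> int.
Proof.
rewrite -nbrs_in_below; apply: card_partial_coloringsU1_leif => //.
exact: notin_below.
Qed.

Lemma card_partial_colorings_perfect_elimination (q : nat) (S : {set T}) :
  perfect_elimination e -> initial_segment S ->
  #|partial_colorings e q S|%:R
    = \prod_(v in S) (q%:R - #|lower_nbrs e v|%:R) :> int.
Proof.
move=> peo; move: S; apply: initial_segment_ind => [|v IHv].
  by rewrite card_partial_colorings0 big_set0.
rewrite big_setU1 ?notin_below //= -IHv; apply/esym/eqP.
rewrite (card_partial_colorings_below_leif q v).2; apply/forall_inP => g gC.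
apply/imset_injP/(partial_coloring_clique_inj gC _ (peo v)).
exact: lower_nbrs_below.
Qed.

Lemma lower_degree_poly_chromatic :
  perfect_elimination e -> is_chromatic_poly e (lower_degree_poly e).
Proof.
move=> peo q; rewrite horner_lower_degree_poly -card_partial_coloringsT.
have initT := @initial_segmentT d T.
rewrite (card_partial_colorings_perfect_elimination q peo initT).
by apply: eq_bigl => v; rewrite inE.
Qed.

Section NonadjacentLowerNeighbours.
Variables (q : nat) (v a b : T).
Hypotheses (Tq : (#|T| <= q)%N) (aN : a \in lower_nbrs e v)
  (bN : b \in lower_nbrs e v) (neq_ab : a != b) (nadj_ab : ~~ e a b).

Lemma card_partial_colorings_below_lteif (w : T) :
  (q%:R - #|lower_nbrs e w|%:R) * #|partial_colorings e q (below w)|%:R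
    < #|partial_colorings e q (w |: below w)|%:R ?<= if (w != v) :> int.
Proof.
case: eqVneq => [->|_]; last exact: (card_partial_colorings_below_leif q w).1.
rewrite /= (lt_leif (card_partial_colorings_below_leif q v)) negb_forall_in.
have below_v := subsetP (lower_nbrs_below e v).
have [g gC gab] := nonadjacent_same_color e_sym e_irr Tq (below_v a aN)
  (below_v b bN) nadj_ab.
apply/exists_inP; exists g => //.
by apply: contra_neqN neq_ab => /imset_injP; apply.
Qed.

Lemma prod_lt_card_partial_colorings (S : {set T}) : initial_segment S ->
  \prod_(x in S) (q%:R - #|lower_nbrs e x|%:R)
    < #|partial_colorings e q S|%:R ?<= if (v \notin S) :> int.
Proof.
move: S; apply: initial_segment_ind => [|w IHw].
  by rewrite card_partial_colorings0 big_set0 inE.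
rewrite big_setU1 ?notin_below // in_setU1 negb_or eq_sym andbC.
apply: lteif_trans (card_partial_colorings_below_lteif w).
rewrite lteif_pM2l // subr_gt0 ltr_nat.
exact: leq_trans (card_lower_nbrs_lt e w) Tq.
Qed.

Lemma lower_degree_poly_lt_num_colorings :
  (lower_degree_poly e).[q%:R] < (num_colorings e q)%:R.
Proof.
rewrite horner_lower_degree_poly -card_partial_coloringsT.
have := prod_lt_card_partial_colorings (@initial_segmentT d T).
rewrite in_setT; congr (_ < _); apply: eq_bigl => x; exact: in_setT.
Qed.

End NonadjacentLowerNeighbours.

Lemma chromatic_poly_eq_lower_degree_poly :
  chromatic_poly e = lower_degree_poly e <-> perfect_elimination e.
Proof.
split=> [chE v a b aN bN neq_ab|peo]; last first.
  exact/esym/chromatic_poly_unique/lower_degree_poly_chromatic.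
apply: contraT => nadj_ab.
have := lower_degree_poly_lt_num_colorings (leqnn _) aN bN neq_ab nadj_ab.
by rewrite -chE chromatic_polyP ltxx.
Qed.

End ChromaticPolynomial.

Section IncreasingRelations.
Variables (d : Order.disp_t) (T : finOrderType d) (r : rel T).
Hypothesis r_sym : symmetric r.

Lemma component_min_exists (v : T) :
  exists2 m, component_min r m & connect r m v.
Proof.
have [m vm mmin] := Order.TotalTheory.arg_minP id (connect0 r v).
exists m; last by rewrite (sym_connect_sym r_sym).
by apply/forallP => y; apply/implyP => my; apply: mmin; apply: connect_trans my.
Qed.

Lemma increasing_from_mem_path (x v z : T) (p : seq T) :
  increasing_from r x -> path r x (rcons p v) -> uniq (x :: rcons p v) ->
  z \in lower_nbrs r v -> z \in x :: p.
Proof.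
move=> /increasing_fromP inc pv uv; rewrite inE => /andP[rvz zv].
apply: contraT => zp; have : path <%O x (rcons (rcons p v) z).
  apply: inc; first by rewrite rcons_path pv last_rcons.
  rewrite -rcons_cons rcons_uniq uv andbT -rcons_cons mem_rcons inE negb_or.
  by rewrite lt_eqF.
by rewrite rcons_path last_rcons => /andP[_ /lt_trans/(_ zv)]; rewrite ltxx.
Qed.

(* [y] lies on the path.  If it came before [last x p], cutting the path at [y]
   and going on to [v] would leave the lower neighbour [last x p] of [v] off. *)
Lemma increasing_from_lower_nbr (x v y : T) (p : seq T) :
  increasing_from r x -> path r x (rcons p v) -> uniq (x :: rcons p v) ->
  y \in lower_nbrs r v -> y = last x p.
Proof.
move=> inc pv uv yN; have yp := increasing_from_mem_path inc pv uv yN.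
have lt_v : (last x p < v)%O.
  by have := increasing_fromP _ _ inc _ pv uv; rewrite rcons_path => /andP[].
have ryv : r y v by move: yN; rewrite inE r_sym => /andP[].
case/splitPl: yp pv uv lt_v => p1 p2 p1y.
rewrite rcons_path cat_path last_cat p1y => /andP[/andP[pp1 _] rlv].
rewrite -rcons_cons rcons_uniq -cat_cons mem_cat negb_or => /andP[/andP[vp1 _]].
rewrite cat_uniq => /and3P[up1 /hasPn p2_off _] lt_v.
have : last y p2 \in x :: p1.
  apply: (increasing_from_mem_path (v := v) inc).
  - by rewrite rcons_path pp1 p1y.
  - by rewrite -rcons_cons rcons_uniq vp1.
  - by rewrite inE r_sym rlv.
case: p2 p2_off {rlv lt_v} => [//|z p2] p2_off.
by rewrite (negPf (p2_off _ (mem_last z p2))).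
Qed.

Lemma increasing_lower_nbrs_le1 :
  (forall x, component_min r x -> increasing_from r x) ->
  forall v, (#|lower_nbrs r v| <= 1)%N.
Proof.
move=> incr v; have [m mmin mv] := component_min_exists v.
have /connectP[p0 /shortenP[p pp up _] pv] := mv.
case/lastP: p => [|p w] in pp up pv *.
  suff -> : lower_nbrs r v = set0 by rewrite cards0.
  apply/setP => x; rewrite !inE pv /=; apply/negP => /andP[mx].
  by rewrite ltNge (implyP (forallP mmin x)) ?connect1.
move: pp up; rewrite last_rcons in pv; rewrite -pv => pp up.
have parent_v := increasing_from_lower_nbr (incr m mmin) pp up.
apply/card_le1_eqP => a b aN bN /=.
by rewrite (parent_v a aN) (parent_v b bN).
Qed.

Section AtMostOneLowerNeighbour.
Hypothesis lower_le1 : forall v, (#|lower_nbrs r v| <= 1)%N.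

(* The largest vertex of a cycle would have two lower neighbours. *)
Lemma lower_nbrs_le1_acyclic : acyclic r.
Proof.
apply/acyclicP => c cc uc; rewrite ltnNge; apply/negP => c_ge3.
have [x0 x0c] : exists x0, x0 \in c.
  by case: c c_ge3 {cc uc} => // x c _; exists x; rewrite mem_head.
have [v vc vmax] := Order.TotalTheory.arg_maxP id x0c.
have [i s cE] := rot_to vc.
have v_notin_s : v \notin s by move: uc; rewrite -(rot_uniq i) cE => /andP[].
have s_lt_v x : x \in s -> (x < v)%O.
  move=> xs; have xc : x \in c by rewrite -(mem_rot i) cE inE xs orbT.
  by rewrite lt_neqAle (memPn v_notin_s) //; apply: vmax.
move: cc uc c_ge3; rewrite -(rot_cycle i) -(rot_uniq i) -(size_rot i) cE.
case: s s_lt_v {cE v_notin_s} => [//|a s]; case/lastP: s => [//|s b] s_lt_v.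
rewrite /= rcons_path last_rcons => /andP[va /andP[_ bv]] /and3P[_ a_notin _] _.
have aN : a \in lower_nbrs r v by rewrite inE va s_lt_v ?mem_head.
have bN : b \in lower_nbrs r v.
  by rewrite inE r_sym bv s_lt_v // inE mem_rcons mem_head orbT.
by rewrite (card_le1_eqP (lower_le1 v) a b aN bN) mem_rcons mem_head in a_notin.
Qed.

Lemma lower_nbrs_le1_increasing (x : T) :
  component_min r x -> increasing_from r x.
Proof.
move=> xmin; apply/increasing_fromP; elim/last_ind => // p z IHp.
rewrite rcons_path -rcons_cons rcons_uniq => /andP[pp yz] /andP[zp up].
have inc := IHp pp up; rewrite rcons_path inc /=.
have [//|zy|zy] := ltgtP (last x p) z; last by rewrite -zy mem_last in zp.
case/lastP: p => [|p y] in zp up inc pp yz zy {IHp} *.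
  by move: zy; rewrite ltNge (implyP (forallP xmin z)) ?connect1.
move: inc pp yz zy; rewrite !rcons_path last_rcons.
move=> /andP[_ wy] /andP[_ rwy] ryz zy.
have zN : z \in lower_nbrs r y by rewrite inE ryz.
have wN : last x p \in lower_nbrs r y by rewrite inE r_sym rwy.
have zw := card_le1_eqP (lower_le1 y) _ _ wN zN.
by rewrite zw -rcons_cons mem_rcons inE mem_last orbT in zp.
Qed.

End AtMostOneLowerNeighbour.
End IncreasingRelations.

Lemma subgraph_sym (T : finType) (F : {set {set T}}) : symmetric (subgraph F).
Proof. by move=> x y; rewrite /subgraph /= setUC. Qed.

Lemma set2_eq_or_swap (T : finType) (x y a b : T) :
  [set x; y] = [set a; b] -> x = a /\ y = b \/ x = b /\ y = a.
Proof.
move=> xyab; have := set21 x y; have := set22 x y; rewrite xyab.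
move=> /set2P y_ab /set2P x_ab; have := set21 a b; have := set22 a b.
rewrite -xyab => /set2P b_xy /set2P a_xy.
by case: x_ab y_ab a_xy b_xy => ? [] ? [] ? [] ?; subst; auto.
Qed.

Lemma mem_edges (T : finType) (e : rel T) (x y : T) :
  symmetric e -> ([set x; y] \in edges e) = e x y.
Proof.
move=> e_sym; apply/imsetP/idP => [[[a b]]|exy]; last first.
  by exists (x, y); rewrite // inE.
by rewrite inE /= => eab /set2_eq_or_swap[[-> ->]|[-> ->]] //; rewrite e_sym.
Qed.

Section SignedMonomials.
Local Open Scope ring_scope.

Definition signed_monomial (n k : nat) : {poly int} := (-1) ^+ k *: 'X^(n - k).

Lemma prod_signed_monomial (I : finType) (n k : I -> nat) :
  (forall i, (k i <= n i)%N) ->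
  \prod_i signed_monomial (n i) (k i)
    = signed_monomial (\sum_i n i) (\sum_i k i).
Proof. by move=> kn; rewrite scaler_prod !prodrXr sumnB. Qed.

End SignedMonomials.

Section IncreasingForests.
Variables (d : Order.disp_t) (T : finOrderType d).
Implicit Types (F : {set {set T}}) (p : {ffun T -> {set T}}).

Definition lower_nbr_map F : {ffun T -> {set T}} :=
  [ffun v => lower_nbrs (subgraph F) v].

Definition lower_nbr_edges p : {set {set T}} := edges [rel v x | x \in p v].

Lemma set2_lt_inj (v w x y : T) : (x < v)%O -> (y < w)%O ->
  [set v; x] = [set w; y] -> v = w /\ x = y.
Proof.
move=> xv yw /set2_eq_or_swap[//|[vy xw]].
by move: xv; rewrite vy xw => /(lt_trans yw); rewrite ltxx.
Qed.

Section LowerNeighbourEdges.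
Variable p : {ffun T -> {set T}}.
Hypothesis p_lt : forall v x, x \in p v -> (x < v)%O.

Lemma mem_lower_nbr_edges (v x : T) : (x < v)%O ->
  ([set v; x] \in lower_nbr_edges p) = (x \in p v).
Proof.
move=> xv; apply/imsetP/idP => [[[w y]]|xp]; last first.
  by exists (v, x); rewrite ?inE.
by rewrite inE /= => yp /set2_lt_inj[]// => [|-> ->//]; apply: p_lt.
Qed.

Lemma lower_nbr_edgesK : lower_nbr_map (lower_nbr_edges p) = p.
Proof.
apply/ffunP => v; rewrite ffunE; apply/setP => x; rewrite inE /subgraph /=.
have [xv|vx] := boolP (x < v)%O; first by rewrite andbT mem_lower_nbr_edges.
by rewrite andbF; apply/esym; apply: contraNF vx; apply: p_lt.
Qed.

Lemma card_lower_nbr_edges : #|lower_nbr_edges p| = (\sum_v #|p v|)%N.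
Proof.
rewrite card_in_imset => [|[v x] [w y]]; last first.
  rewrite !inE /= => /p_lt xv /p_lt yw.
  by move=> /(set2_lt_inj xv yw)[-> ->].
under [RHS]eq_bigr do rewrite -sum1_card.
by rewrite pair_big_dep -sum1_card; apply: eq_bigl => u; rewrite inE.
Qed.

End LowerNeighbourEdges.

Lemma lower_nbr_map_lt F (v x : T) : x \in lower_nbr_map F v -> (x < v)%O.
Proof. by rewrite ffunE inE => /andP[]. Qed.

Section SpanningForests.
Variable e : rel T.
Hypotheses (e_sym : symmetric e) (e_irr : irreflexive e).

Lemma lower_nbr_mapK F :
  F \subset edges e -> lower_nbr_edges (lower_nbr_map F) = F.
Proof.
move=> Fe; have mem_lt v x : (x < v)%O ->
    ([set v; x] \in lower_nbr_edges (lower_nbr_map F)) = ([set v; x] \in F).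
  move=> xv; rewrite mem_lower_nbr_edges //; last exact: lower_nbr_map_lt.
  by rewrite ffunE inE xv andbT.
apply/setP => A; apply/idP/idP => [AF|AF].
  have /imsetP[[v x]] := AF; rewrite inE /= => xv AE.
  by rewrite AE -mem_lt -?AE //; apply: lower_nbr_map_lt xv.
have /imsetP[[v x]] := subsetP Fe A AF; rewrite inE /= => evx AE.
move: AF; rewrite AE; have [vx|xv|vx] := ltgtP v x.
- by rewrite setUC mem_lt.
- by rewrite mem_lt.
- by move: evx; rewrite vx e_irr.
Qed.

Lemma increasing_spanning_forestE F :
  increasing_spanning_forest e F
    = (F \subset edges e) && [forall v, #|lower_nbrs (subgraph F) v| <= 1]%N.
Proof.
have Fsym := @subgraph_sym _ F; rewrite /increasing_spanning_forest -andbA.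
apply: andb_id2l => Fe; apply/andP/forallP => [[_ incr]|lower_le1].
  apply: increasing_lower_nbrs_le1 => // x.
  by move/forallP/(_ x)/implyP: incr.
split; first exact: lower_nbrs_le1_acyclic.
by apply/forallP => x; apply/implyP; apply: lower_nbrs_le1_increasing.
Qed.

Definition parent_sets (v : T) : pred {set T} :=
  [pred A : {set T} | A \subset lower_nbrs e v & (#|A| <= 1)%N].

Lemma parent_sets_lt p :
  p \in family parent_sets -> forall v x, x \in p v -> (x < v)%O.
Proof.
move=> /familyP pP v x; have /andP[/subsetP pN _] := pP v.
by move=> /pN; rewrite inE => /andP[].
Qed.

Lemma lower_nbr_map_family F : increasing_spanning_forest e F ->
  lower_nbr_map F \in family parent_sets.
Proof.
rewrite increasing_spanning_forestE => /andP[Fe /forallP F_le1].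
apply/familyP => v; rewrite inE ffunE F_le1 andbT.
apply/subsetP => x; rewrite !inE => /andP[Fvx ->].
by rewrite andbT -mem_edges //; apply: (subsetP Fe).
Qed.

Lemma lower_nbr_edges_isf p : p \in family parent_sets ->
  increasing_spanning_forest e (lower_nbr_edges p).
Proof.
move=> pP; have pK := lower_nbr_edgesK (parent_sets_lt pP).
have {}pP v := familyP pP v; rewrite increasing_spanning_forestE.
apply/andP; split.
  apply/subsetP => _ /imsetP[[v x] + ->]; rewrite inE /= => xp.
  have /andP[/subsetP/(_ x xp)] := pP v.
  by rewrite mem_edges // inE => /andP[].
apply/forallP => v; have /andP[_] := pP v.
by rewrite -[in p v]pK ffunE.
Qed.

Lemma card_increasing_spanning_forest_lt F : (0 < #|T|)%N ->
  increasing_spanning_forest e F -> (#|F| < #|T|)%N.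
Proof.
move=> /card_gt0P[x0 _]; rewrite increasing_spanning_forestE.
move=> /andP[Fe /forallP F_le1].
have [m _ mmin] := Order.TotalTheory.arg_minP id (isT : predT x0).
rewrite -(lower_nbr_mapK Fe) card_lower_nbr_edges;
  last exact: lower_nbr_map_lt.
rewrite -sum1_card (bigD1 m) //= [ltnRHS](bigD1 m) //= -addSn leq_add //.
  rewrite ltnS leqn0 cards_eq0 ffunE; apply/eqP/setP => x.
  by rewrite !inE ltNge mmin ?andbF.
by apply: leq_sum => v _; rewrite ffunE.
Qed.

Local Open Scope ring_scope.

Lemma isf_poly_sum : (0 < #|T|)%N ->
  isf_poly e
    = \sum_(F | increasing_spanning_forest e F) signed_monomial #|T| #|F|.
Proof.
move=> T_gt0; pose size_ord F := insubd (Ordinal T_gt0) #|F|.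
rewrite [RHS](partition_big size_ord predT) //=.
apply: eq_bigr => k _.
rewrite (eq_bigl [in [set F | increasing_spanning_forest e F & #|F| == k]]).
  rewrite (eq_bigr (fun=> signed_monomial #|T| k)).
    by rewrite sumr_const /signed_monomial -scaler_nat scalerA mulrC.
  by move=> F; rewrite inE => /andP[_ /eqP->].
move=> F; rewrite inE; apply: andb_id2l => isfF.
by rewrite -val_eqE val_insubd card_increasing_spanning_forest_lt.
Qed.

Lemma sum_parent_sets (v : T) :
  \sum_(A | parent_sets v A) signed_monomial 1 #|A|
    = 'X - #|lower_nbrs e v|%:R%:P.
Proof.
rewrite (bigD1 set0) /=; last by rewrite /parent_sets /= sub0set cards0.
rewrite cards0 [signed_monomial 1 0]scale1r; congr (_ + _).
pose singletons := [set A : {set T} | A \subset lower_nbrs e v & #|A| == 1%N].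
rewrite (eq_bigl [in singletons]).
  rewrite (eq_bigr (fun=> -1)); last first.
    move=> A; rewrite inE => /andP[_ /eqP->].
    by rewrite /signed_monomial scaleN1r.
  by rewrite sumr_const cards_draws bin1 mulNrn polyC_natr.
move=> A; rewrite inE -cards_eq0 -andbA.
by case: #|A| => [|[|k]]; rewrite ?andbF.
Qed.

Lemma isf_poly_eq_lower_degree_poly :
  (0 < #|T|)%N -> isf_poly e = lower_degree_poly e.
Proof.
move=> T_gt0; rewrite isf_poly_sum //.
under [RHS]eq_bigr do rewrite -sum_parent_sets.
rewrite bigA_distr_big_dep.
rewrite (reindex_onto lower_nbr_edges lower_nbr_map); last first.
  by move=> F; rewrite increasing_spanning_forestE => /andP[/lower_nbr_mapK].
apply: eq_big => [p|p].
  apply/andP/idP => [[isfp /eqP <-]|pP]; first exact: lower_nbr_map_family.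
  by rewrite lower_nbr_edges_isf // (lower_nbr_edgesK (parent_sets_lt pP)).
move=> /andP[/lower_nbr_map_family + /eqP pE]; rewrite pE => pP.
rewrite card_lower_nbr_edges; last exact: parent_sets_lt pP.
rewrite -sum1_card prod_signed_monomial // => v.
by have /andP[] := familyP pP v.
Qed.

End SpanningForests.
End IncreasingForests.

Theorem theorem6p4 (d : Order.disp_t) (T : finOrderType d) (e : rel T)
    (T_gt0 : 0 < #|T|) (e_sym : symmetric e) (e_irr : irreflexive e) :
  chromatic_poly e = isf_poly e <-> perfect_elimination e.
Proof.
rewrite isf_poly_eq_lower_degree_poly //.
exact: chromatic_poly_eq_lower_degree_poly.
Qed.
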